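(* Let $k:\mathbb{R}\times\mathbb{R}\to\mathbb{R}$ be Borel. Then the predicate $$K(s):=\mathrm{ess}\text{-}\lim_{x\to\infty}k(s,x)$$ is of ambiguous analytical class $\mathbf{\Delta}^1_2$; that is, the set $$\{(s,L)\in\mathbb{R}\times\mathbb{R}:\ \mathrm{ess}\text{-}\lim_{x\to\infty}k(s,x)=L\}$$ is a $\mathbf{\Delta}^1_2$ subset of $\mathbb{R}^2$.
   Context: Essential limit: for a function $f:\mathbb{R}\to\mathbb{R}$ and $L\in\mathbb{R}$, $\mathrm{ess}\text{-}\lim_{x\to\infty}f(x)=L$ means that for each $\varepsilon>0$ there are $X_\varepsilon\in\mathbb{R}$ and a meagre set $M_\varepsilon$ such that $|f(x)-L|<\varepsilon$ for all $x>X_\varepsilon$ with $x\notin M_\varepsilon$. $\mathbf{\Sigma}^1_2$ (boldface) is the class of projections of coanalytic sets, $\mathbf{\Pi}^1_2$ the class of complements of $\mathbf{\Sigma}^1_2$ sets, and $\mathbf{\Delta}^1_2=\mathbf{\Sigma}^1_2\cap\mathbf{\Pi}^1_2$. *)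

(* Defs.v *)
From HB Require Import structures.
From mathcomp Require Import all_boot all_order all_algebra.
From mathcomp Require Import all_classical all_reals all_analysis.
Import Order.TTheory GRing.Theory Num.Theory.
Import numFieldNormedType.Exports.

Set Implicit Arguments.
Unset Strict Implicit.
Unset Printing Implicit Defensive.

Local Open Scope classical_set_scope.
Local Open Scope ring_scope.

Definition borel (T : topologicalType) (A : set T) : Prop := <<s open >> A.

Definition borel_fun (T U : topologicalType) (f : T -> U) : Prop :=
  forall B : set U, borel B -> borel (f @^-1` B).

Definition nowhere_dense (T : topologicalType) (A : set T) : Prop :=
  (closure A)° = set0.

Definition meagre (T : topologicalType) (A : set T) : Prop :=
  exists2 F : nat -> set T,
    (forall n, nowhere_dense (F n)) & A = \bigcup_n F n.

Definition ess_lim (R : realType) (f : R -> R) (L : R) : Prop :=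
  forall e : R, 0 < e ->
    exists (X : R) (M : set R),
      meagre M /\ forall x, X < x -> ~ M x -> `|f x - L| < e.

(* The boldface projective classes, in Lusin's form: all projections are along
   a factor [R], the real line.  They are the usual classes when [T] is Polish,
   since any two uncountable Polish spaces are Borel isomorphic. *)
Section ProjectiveClasses.
Variable R : realType.

Definition analytic (T : topologicalType) (A : set T) : Prop :=
  exists2 B : set (T * R), borel B & A = fst @` B.

Definition coanalytic (T : topologicalType) (A : set T) : Prop :=
  analytic (~` A).

Definition Sigma12 (T : topologicalType) (A : set T) : Prop :=
  exists2 B : set (T * R), coanalytic B & A = fst @` B.

Definition Pi12 (T : topologicalType) (A : set T) : Prop := Sigma12 (~` A).

Definition Delta12 (T : topologicalType) (A : set T) : Prop :=
  Sigma12 A /\ Pi12 A.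

End ProjectiveClasses.

(* Main.v *)
(* The set is in fact Borel, hence Delta^1_2 since projecting a cylinder over a
   Borel set gives that set back. The quantifiers over e and X in the essential
   limit may be restricted to countable sets, so that the set becomes a countable
   combination of sets [{p | A_p is meagre}], where A is Borel in the plane times
   the line and A_p is its section at p; such sets are Borel by the
   Montgomery-Novikov theorem on the category quantifier. *)
Require Import Defs.
From HB Require Import structures.
From mathcomp Require Import all_boot all_order all_algebra.
From mathcomp Require Import all_classical all_reals all_analysis.
Import Order.TTheory GRing.Theory Num.Theory.
Import numFieldNormedType.Exports.

Set Implicit Arguments.
Unset Strict Implicit.
Unset Printing Implicit Defensive.

Local Open Scope classical_set_scope.
Local Open Scope ring_scope.

(** Reindexes countable unions by [nat], as the definitions require; numbers that code no index
    contribute the empty set. *)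
Lemma bigcup_unpickle (T : Type) (I : countType) (F : I -> set T) :
  \bigcup_i F i = \bigcup_n oapp F set0 (unpickle n).
Proof.
apply/seteqP; split=> [x [i _ Fx]|x [n _]].
  by exists (pickle i) => //; rewrite pickleK.
by case: unpickle => //= i Fx; exists i.
Qed.

(** * Closure properties of Borel sets *)

Lemma borel_open (T : topologicalType) (A : set T) : open A -> borel A.
Proof. exact: sub_gen_smallest. Qed.

Lemma borelC (T : topologicalType) (A : set T) : borel A -> borel (~` A).
Proof. by move=> bA; rewrite -setTD; apply: sigma_algebraCD. Qed.

Lemma borel_bigcup (T : topologicalType) (I : countType) (F : I -> set T) :
  (forall i, borel (F i)) -> borel (\bigcup_i F i).
Proof.
move=> bF; rewrite bigcup_unpickle; apply: sigma_algebra_bigcup => n.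
by case: unpickle => [i|] /=; [exact: bF|exact: borel_open open0].
Qed.

Lemma borel_bigcap (T : topologicalType) (I : countType) (F : I -> set T) :
  (forall i, borel (F i)) -> borel (\bigcap_i F i).
Proof.
move=> bF; rewrite -(setCK (\bigcap_i F i)) setC_bigcap.
by apply: borelC; apply: borel_bigcup => i; exact: borelC.
Qed.

Lemma borelU (T : topologicalType) (A B : set T) :
  borel A -> borel B -> borel (A `|` B).
Proof.
move=> bA bB; rewrite -bigcup2E.
by apply: borel_bigcup => -[|[|n]] //=; exact: borel_open open0.
Qed.

Lemma borelI (T : topologicalType) (A B : set T) :
  borel A -> borel B -> borel (A `&` B).
Proof.
move=> bA bB; rewrite -(setCK (A `&` B)) setCI.
by apply: borelC; apply: borelU; exact: borelC.
Qed.

Lemma borel_preimage (T U : topologicalType) (f : T -> U) :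
  continuous f -> borel_fun f.
Proof.
move=> cf B; apply: (@smallest_sub _ _ _ [set B | borel (f @^-1` B)]).
  split=> /= [|C bC|F bF].
  - by rewrite preimage_set0; exact: borel_open open0.
  - by rewrite setTD preimage_setC; exact: borelC.
  - by rewrite preimage_bigcup; exact: borel_bigcup.
by move=> C oC; apply: borel_open; apply: open_comp => // x _; exact: cf.
Qed.

Lemma continuous_fst (T U : topologicalType) : continuous (@fst T U).
Proof. by move=> p; exact: cvg_fst. Qed.

Lemma continuous_snd (T U : topologicalType) : continuous (@snd T U).
Proof. by move=> p; exact: cvg_snd. Qed.

Lemma borel_Delta12 (R : realType) (T : topologicalType) (A : set T) :
  borel A -> Delta12 R A.
Proof.
have Sigma12_borel (B : set T) : borel B -> Sigma12 R B.
  move=> bB; exists (fst @^-1` B); last first.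
    by apply/seteqP; split=> [x Bx|_ [p Bp <-]] //; exists (x, 0).
  (* The complement of a cylinder is again a cylinder, hence the projection of a cylinder one
     dimension up. *)
  exists (fst @^-1` (fst @^-1` (~` B))).
    apply: (borel_preimage (@continuous_fst _ _)).
    apply: (borel_preimage (@continuous_fst _ _)).
    exact: borelC.
  by apply/seteqP; split=> [p Bp|_ [p Bp <-]] //; exists (p, 0).
by move=> bA; split; apply: Sigma12_borel => //; exact: borelC.
Qed.

(** * Meagre sets *)

Lemma nowhere_denseS (T : topologicalType) (A B : set T) :
  A `<=` B -> nowhere_dense B -> nowhere_dense A.
Proof.
rewrite /nowhere_dense -!subset0 => AB; apply: subset_trans.
exact/interiorS/closureS.
Qed.

Lemma meagreS (T : topologicalType) (A B : set T) :
  A `<=` B -> meagre B -> meagre A.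
Proof.
(* [meagre] asks for equality with the union, so the pieces are trimmed to [A]. *)
move=> AB [F ndF BE]; exists (fun n => F n `&` A).
  by move=> n; apply: nowhere_denseS (ndF n) => x [].
by rewrite -setI_bigcupl -BE setIidr.
Qed.

Lemma nowhere_dense_meagre (T : topologicalType) (A : set T) :
  nowhere_dense A -> meagre A.
Proof. by move=> ndA; exists (fun=> A) => //; rewrite bigcup_const. Qed.

Lemma meagre0 (T : topologicalType) : meagre (@set0 T).
Proof.
by apply: nowhere_dense_meagre; rewrite /nowhere_dense closure0 interior0.
Qed.

Lemma meagre_bigcup (T : topologicalType) (I : countType) (F : I -> set T) :
  (forall i, meagre (F i)) -> meagre (\bigcup_i F i).
Proof.
move=> mF; rewrite bigcup_unpickle.
have /choice[G GE] n : exists G : nat -> set T,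
    (forall m, nowhere_dense (G m)) /\ oapp F set0 (unpickle n) = \bigcup_m G m.
  have : meagre (oapp F set0 (unpickle n)).
    by case: unpickle => [i|] /=; [exact: mF|exact: meagre0].
  by move=> [G ? ?]; exists G.
pose H (p : nat * nat) := G p.1 p.2.
exists (fun n => oapp H set0 (unpickle n)).
  move=> n; case: unpickle => [p|] /=.
    by have [ndG _] := GE p.1; exact: ndG.
  by rewrite /nowhere_dense closure0 interior0.
rewrite -(bigcup_unpickle H); apply/seteqP; split=> [x [n _]|x [[n m] _ Hx]].
  by case: (GE n) => _ -> [m _ Gx]; exists (n, m).
by exists n => //; case: (GE n) => _ ->; exists m.
Qed.

Lemma meagreU (T : topologicalType) (A B : set T) :
  meagre A -> meagre B -> meagre (A `|` B).
Proof.
move=> mA mB; rewrite -bigcup2E.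
by apply: meagre_bigcup => -[|[|n]] //=; exact: meagre0.
Qed.

(** * Baire spaces and a local Baire property *)

Definition baire_space (T : topologicalType) : Prop :=
  forall U : set T, open U -> U !=set0 -> ~ meagre U.

Definition pi_base (T : topologicalType) (I : Type) (V : I -> set T) : Prop :=
  [/\ forall i, open (V i), forall i, V i !=set0 &
      forall U, open U -> U !=set0 -> exists i, V i `<=` U].

(* A weakening of the Baire property whose stability under complements and
   countable unions has a direct proof. *)
Definition locally_comeagre (T : topologicalType) (A : set T) : Prop :=
  forall U, open U -> ~ meagre (U `&` A) ->
    exists W, [/\ open W, W !=set0, W `<=` U & meagre (W `\` A)].

Lemma locally_comeagre_open (T : topologicalType) (A : set T) :
  open A -> locally_comeagre A.
Proof.
move=> oA U oU nm; exists (U `&` A); split.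
- exact: openI.
- by apply/set0P/eqP => UA0; apply: nm; rewrite UA0; exact: meagre0.
- exact: subIsetl.
- by apply: meagreS (@meagre0 T) => y [[]].
Qed.

Lemma locally_comeagre_bigcup (T : topologicalType) (I : countType)
    (F : I -> set T) :
  (forall i, locally_comeagre (F i)) -> locally_comeagre (\bigcup_i F i).
Proof.
move=> lF U oU nm.
have [i nmi] : exists i, ~ meagre (U `&` F i).
  apply/existsNP => mF; apply: nm; rewrite setI_bigcupr.
  exact: meagre_bigcup.
have [W [oW W0 WU mW]] := lF i U oU nmi; exists W; split=> //.
by apply: meagreS mW; apply: setDS; exact: bigcup_sup.
Qed.

(** If no nonempty open subset of [U] meets [A] in a meagre set, then each [V i] inside [U] contains
    a nonempty open [W i] in which [A] is comeagre. These [W i] are dense in [U], so [U] minus [A]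
    is covered by a nowhere dense set and countably many meagre sets. *)
Lemma locally_comeagreC (T : topologicalType) (I : countType) (V : I -> set T)
    (A : set T) :
  pi_base V -> locally_comeagre A -> locally_comeagre (~` A).
Proof.
move=> [oV V0 Vsub] lA U oU nm; apply: contrapT => noW; apply: nm.
have /choice[W WP] i : exists W, V i `<=` U ->
    [/\ open W, W !=set0, W `<=` V i & meagre (W `\` A)].
  have [ViU|?] := pselect (V i `<=` U); last by exists set0.
  have [|W WP] := lA (V i) (oV i); last by exists W.
  by move=> m; apply: noW; exists (V i); split=> //; rewrite setDE setCK.
pose D := [set i | V i `<=` U].
have ndU : nowhere_dense (U `\` \bigcup_(i in D) W i).
  rewrite /nowhere_dense -subset0 => y.
  rewrite /interior/= nbhsE => -[B [oB By] BU].
  have [z [[Uz _] Bz]] := BU y By B (open_nbhs_nbhs (conj oB By)).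
  have [|i ViBU] := Vsub (B `&` U) (openI oB oU); first by exists z.
  have Di : D i by move=> t /ViBU[].
  have [oW [w Ww] WV _] := WP i Di.
  have [Bw _] := ViBU _ (WV _ Ww).
  have [t [[_ nt] Wt]] := BU w Bw (W i) (open_nbhs_nbhs (conj oW Ww)).
  by apply: nt; exists i.
apply: (@meagreS _ _ ((U `\` \bigcup_(i in D) W i) `|`
    \bigcup_i [set y | D i /\ (W i `\` A) y])).
  move=> y [Uy nAy]; have [[i Di Wy]|nW] := pselect ((\bigcup_(i in D) W i) y).
    by right; exists i.
  by left.
apply: meagreU; first exact: nowhere_dense_meagre.
apply: meagre_bigcup => i; have [Di|nDi] := pselect (D i).
  by have [_ _ _] := WP i Di; apply: meagreS => y [].
by apply: meagreS (@meagre0 T) => y [].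
Qed.

(** Handles complements under the category quantifier. If [U] minus [A] and [V i] meet [A] were both
    meagre, so would be [V i], against Baire. Conversely, if [U] minus [A] is nonmeagre, then [A] is
    meagre in some nonempty open subset of [U], hence in some [V i]. *)
Lemma meagre_setDP (T : topologicalType) (I : countType) (V : I -> set T)
    (A U : set T) :
  baire_space T -> pi_base V -> locally_comeagre (~` A) -> open U ->
  meagre (U `\` A) <-> forall i, V i `<=` U -> ~ meagre (V i `&` A).
Proof.
move=> bT [oV V0 Vsub] lA oU; split=> [mU i ViU mA|nmA].
  apply: (bT (V i)) => //; apply: meagreS (meagreU mU mA) => y Vy.
  by have [Ay|nAy] := pselect (A y); [right|left; split=> //; exact: ViU].
apply: contrapT => nm; have [W [oW W0 WU mW]] := lA U oU nm.
have [i ViW] := Vsub W oW W0; apply: (nmA i); first exact: subset_trans WU.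
by apply: meagreS mW => y [/ViW Wy Ay]; split=> // /(_ Ay).
Qed.

(* The Montgomery-Novikov theorem for the category quantifier; the induction
   over Borel sets carries the local form of the Baire property of the sections
   along, as it is what makes the complement step work. *)
Lemma borel_meagre_section (X Y : topologicalType) (I : countType)
    (V : I -> set Y) (A : set (X * Y)) (U : set Y) :
  baire_space Y -> pi_base V -> borel A -> open U ->
  borel [set x | meagre (U `&` [set y | A (x, y)])].
Proof.
move=> bY pV bA.
(* All open [U] are treated at once, since the complement step passes from one open set to the [V i]
   inside it. *)
suff [//] : (forall x, locally_comeagre [set y | A (x, y)]) /\
    forall U, open U -> borel [set x | meagre (U `&` [set y | A (x, y)])].
  by move=> _; apply.
move: A bA; apply: smallest_sub => /=; last first.
  move=> A oA.
  have oAx x : open [set y | A (x, y)].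
    apply: (@open_comp _ _ (pair x)) oA => y _.
    by apply: cvg_pair; [exact: cvg_cst|exact: cvg_id].
  split=> [x|W oW]; first exact: locally_comeagre_open.
  (* An open section of [A] within [W] is open, so in a Baire space it is meagre only when empty. *)
  have -> : [set x | meagre (W `&` [set y | A (x, y)])] =
      ~` \bigcup_(y in W) [set x | A (x, y)].
    apply/seteqP; split=> [x m [y Wy Axy]|x nx] /=.
      by apply: (bY _ (openI oW (oAx x))) m; exists y.
    by apply: meagreS (@meagre0 Y) => y [Wy Axy]; apply: nx; exists y.
  apply: borelC; apply: borel_open; apply: bigcup_open => y Wy.
  apply: (@open_comp _ _ (pair^~ y)) oA => x _.
  by apply: cvg_pair; [exact: cvg_id|exact: cvg_cst].
split=> [|A [lA bA]|F FP].
- split=> [x|W oW]; first exact: locally_comeagre_open open0.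
  rewrite (_ : [set _ | _] = setT); first exact: borel_open openT.
  by apply/seteqP; split=> // x _ /=; rewrite setI0; exact: meagre0.
- have lAC x : locally_comeagre (~` [set y | A (x, y)]).
    exact: locally_comeagreC pV (lA x).
  have AC x : [set y | (setT `\` A) (x, y)] = ~` [set y | A (x, y)].
    by rewrite setTD.
  split=> [x|W oW]; first by rewrite AC.
  (* The inclusion of [V i] in [W] does not involve [x], so each term is either Borel by induction
     or the whole space. *)
  rewrite (_ : [set _ | _] = \bigcap_i
      [set x | V i `<=` W -> ~ meagre (V i `&` [set y | A (x, y)])]).
    apply: borel_bigcap => i; have [ViW|nViW] := pselect (V i `<=` W).
      rewrite (_ : [set _ | _] =
          ~` [set x | meagre (V i `&` [set y | A (x, y)])]).
        by apply: borelC; apply: bA; case: pV.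
      by apply/seteqP; split=> x /= h //; exact: h.
    rewrite (_ : [set _ | _] = setT); first exact: borel_open openT.
    by apply/seteqP; split=> // x _ /nViW.
  apply/seteqP; split=> x /=; rewrite AC -setDE (meagre_setDP bY pV (lAC x) oW).
    by move=> h i _; exact: h.
  by move=> h i; exact: h.
- have FE x : [set y | (\bigcup_n F n) (x, y)] = \bigcup_n [set y | F n (x, y)].
    by [].
  split=> [x|W oW].
    by rewrite FE; apply: locally_comeagre_bigcup => n; case: (FP n).
  rewrite (_ : [set _ | _] =
      \bigcap_n [set x | meagre (W `&` [set y | F n (x, y)])]).
    by apply: borel_bigcap => n; case: (FP n) => _; apply.
  apply/seteqP; split=> x /=; rewrite FE setI_bigcupr.
    by move=> m n _; apply: meagreS m => y WFy; exists n.
  by move=> m; apply: meagre_bigcup => n; exact: m.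
Qed.

(** * Baire category and a countable pi-base on the line *)

Lemma baire_space_complete (R : realType) (T : completeNormedModType R) :
  baire_space T.
Proof.
move=> U oU U0 [F ndF UE].
(* The complements of the closures are dense and open, so some point of [U] lies in all of them. *)
have [n|x [Ux]] := @Baire _ T (fun n => ~` closure (F n)) _ U U0 oU.
  split; first by rewrite openC; exact: closed_closure.
  move=> O O0 oO; apply: contrapT => /set0P/negP/negPn/eqP OF0.
  have OF : O `<=` closure (F n).
    by move=> y Oy; apply: contrapT => nF; rewrite -[False]/(set0 y) -OF0.
  by move: OF O0; rewrite open_subsetE// (ndF n) subset0 => -> /set0P/eqP.
by move: Ux; rewrite UE => -[n _ Fx] /(_ n I); apply; exact: subset_closure.
Qed.

Definition rat_ball (R : realType) (i : rat * nat) : set R :=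
  ball (ratr i.1 : R) i.2.+1%:R^-1.

Lemma pi_base_rat_ball (R : realType) : pi_base (@rat_ball R).
Proof.
split=> [i|i|U oU [x Ux]].
- exact: ball_open.
- by exists (ratr i.1); apply: ballxx; rewrite invr_gt0.
have /nbhs_ballP[e /= e0 eU] := open_nbhs_nbhs (conj oU Ux).
have e20 : 0 < e / 2 :> R by rewrite divr_gt0.
(* Both the radius and the distance from [x] to the rational centre are kept below [e / 2]. *)
have [n] := ltr_add_invr e20; rewrite add0r => ne.
have n0 : 0 < n.+1%:R^-1 :> R by rewrite invr_gt0.
have [q] := @rat_in_itvoo R x (x + n.+1%:R^-1) ltac:(by rewrite ltrDl).
rewrite in_itv /= => /andP[xq qx]; exists (q, n) => y qy; apply: eU.
rewrite (splitr e); apply: (@ball_triangle _ _ (ratr q : R)).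
  apply: le_ball (ltW ne) _ _; rewrite /ball/= distrC ger0_norm ?subr_ge0 ?ltW//.
  by rewrite ltrBlDl.
exact: le_ball (ltW ne) _ qy.
Qed.

(** * Essential limits as Borel conditions *)

Lemma borel_ltr_sub (R : realType) (T : topologicalType) (f g : T -> R)
    (c : R) :
  borel_fun f -> borel_fun g -> borel [set x | f x - g x < c].
Proof.
(* A rational between [f x] and [c + g x] separates the two functions. *)
move=> bf bg; rewrite (_ : [set _ | _] = \bigcup_(q : rat)
    (f @^-1` [set u | u < ratr q] `&` g @^-1` [set u | ratr q - c < u])).
  apply: borel_bigcup => q; apply: borelI.
    by apply: bf; apply: borel_open; exact: open_lt.
  by apply: bg; apply: borel_open; exact: open_gt.
apply/seteqP; split=> [x /= fg|x [q _ /= [fq gq]]]; last first.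
  by rewrite ltrBlDr; apply: (lt_trans fq); rewrite -ltrBlDl.
have [q] := @rat_in_itvoo R (f x) (c + g x) ltac:(by rewrite -ltrBlDr).
rewrite in_itv /= => /andP[fq qg]; exists q => //; split=> //=.
by rewrite ltrBlDl.
Qed.

(** Tolerances [1/(m+1)] and natural thresholds suffice by monotonicity, and the bad points beyond
    the threshold form the least exceptional set, which removes the quantifier over [M]. *)
Lemma ess_limP (R : realType) (f : R -> R) (L : R) :
  ess_lim f L <-> forall m : nat, exists n : nat,
    meagre ([set x | n%:R < x] `&` [set x | ~ `|f x - L| < m.+1%:R^-1]).
Proof.
split=> [fL m|fL e e0].
  have [|X [M [mM MP]]] := fL m.+1%:R^-1; first by rewrite invr_gt0.
  exists (Num.truncn `|X|).+1; apply: meagreS mM => x [/= Xx nfx].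
  apply: contrapT => Mx; apply/nfx/MP => //; apply: le_lt_trans Xx.
  by apply: le_trans (ler_norm _) (ltW _); exact: truncnS_gt.
have [m] := ltr_add_invr e0; rewrite add0r => me.
have [n mn] := fL m; exists n%:R; eexists; split; first exact: mn.
move=> x nx nM; apply: lt_trans me; apply: contrapT => nfx.
by apply: nM; split.
Qed.

Theorem theorem7 (R : realType) (k : R * R -> R) (hk : borel_fun k) :
  Delta12 R [set p : R * R | ess_lim (fun x => k (p.1, x)) p.2].
Proof.
apply: borel_Delta12.
(* With [q = ((s, L), x)], these are the points where [k (s, x)] misses [L] by at least [1/(m+1)];
   the category quantifier will act on [x]. *)
pose A (m : nat) :=
  [set q : (R * R) * R | ~ `|k (q.1.1, q.2) - q.1.2| < m.+1%:R^-1].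
have bA m : borel (A m).
  have c11 : continuous (fun q : R * R * R => q.1.1).
    move=> q; apply: continuous_comp; first exact: (@continuous_fst _ _ q).
    exact: (@continuous_fst _ _ q.1).
  have c12 : continuous (fun q : R * R * R => q.1.2).
    move=> q; apply: continuous_comp; first exact: (@continuous_fst _ _ q).
    exact: (@continuous_snd _ _ q.1).
  have csx : continuous (fun q : R * R * R => (q.1.1, q.2)).
    by move=> q; exact: (cvg_pair (c11 q) (@continuous_snd _ _ q)).
  have bk : borel_fun (fun q : R * R * R => k (q.1.1, q.2)).
    by move=> B /hk; exact: (borel_preimage csx).
  have bL := borel_preimage c12.
  rewrite (_ : A m = ~` ([set q | k (q.1.1, q.2) - q.1.2 < m.+1%:R^-1] `&`
      [set q | q.1.2 - k (q.1.1, q.2) < m.+1%:R^-1])).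
    by apply: borelC; apply: borelI; exact: borel_ltr_sub.
  by apply/seteqP; split=> q /=; rewrite /A /= ltr_norml -ltrNl opprB =>
    h; contradict h; [case: h => ? ?; apply/andP|case/andP: h].
rewrite (_ : [set _ | _] = \bigcap_(m : nat) \bigcup_(n : nat)
    [set p | meagre ([set x | n%:R < x] `&` [set x | A m (p, x)])]).
  apply: borel_bigcap => m; apply: borel_bigcup => n.
  apply: borel_meagre_section (bA m) _.
  - exact: (@baire_space_complete R R^o).
  - exact: pi_base_rat_ball.
  - exact: open_gt.
apply/seteqP; split=> p /=; rewrite ess_limP.
  by move=> h m _; have [n ?] := h m; exists n.
by move=> h m; have [n _ ?] := h m I; exists n.
Qed.
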